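(* Let $\mathcal{X}$ be a set, and let $\mathcal{B}(\mathcal{X},E)$ be a GRKBS with configuration $(\mathcal{F},\phi)$. Let $\{x_i\}_{i=1}^N\subset\mathcal{X}$ and $\{y_i\}_{i=1}^N\subset E$ be training data, and let $\mathcal{L}:E\times E\to\mathbb{R}$. Assume: (a) there exists a topology $\tau$ on $\mathcal{F}$ such that $(\mathcal{F},\tau)$ is a locally convex topological space, the norm $\|\cdot\|_{\mathcal{F}}$ is coercive with respect to $\tau$ (i.e. the sets $\{\mu\in\mathcal{F}:\|\mu\|_{\mathcal{F}}\le\alpha\}$ are $\tau$-compact for all $\alpha>0$), and $\|\cdot\|_{\mathcal{F}}$ is lower semi-continuous with respect to $\tau$; (b) $E$ is a finite-dimensional Hilbert space of dimension $m$; (c) $\mathcal{L}$ is convex, proper and coercive with respect to the second variable. Then the abstract training problem associated with $\mathcal{F}$, $$\inf_{\mu\in\mathcal{F}}\Bigl(\frac1N\sum_{i=1}^N\mathcal{L}(y_i,f_\mu(x_i))+\|\mu\|_{\mathcal{F}}\Bigr),$$ has a sparse solution (minimizer) of the form $$\mu^*=\sum_{i=1}^p\gamma_i\mu_i,$$ where $p\le mN$, $\gamma_i>0$ with $\|\mu^*\|_{\mathcal{F}}=\sum_{i=1}^p\gamma_i$, and $\mu_i\in\mathrm{Ext}(B_{\mathcal{F}})$, the set of extremal points of the closed unit ball $B_{\mathcal{F}}$ of $\mathcal{F}$.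
   Context: A GRKBS $\mathcal{B}(\mathcal{X},E)$ is a Banach space of functions $f:\mathcal{X}\to E$ (pointwise operations) for which every evaluation operator $f\mapsto f(x)$ is bounded. A configuration of it is a pair $(\mathcal{F},\phi)$ with $\mathcal{F}$ a Banach space and $\phi:\mathcal{X}\to L_{\mathrm{op}}(\mathcal{F},E)$ (bounded linear operators from $\mathcal{F}$ to $E$) such that $\mathcal{B}=\{f_\mu:\mu\in\mathcal{F}\}$, $f_\mu(x)=\phi(x)(\mu)$, and $\|f\|_{\mathcal{B}}=\inf\{\|\mu\|_{\mathcal{F}}:f=f_\mu\}$. ''Locally convex topological space'' means locally convex topological vector space. Coercivity of $\mathcal{L}$ in the second variable means that for each $y\in E$ the sublevel sets $\{w\in E:\mathcal{L}(y,w)\le\alpha\}$ are compact.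
   Formalization: Added hypothesis: for each training point x_i, the map μ ↦ f_μ(x_i) is continuous from (F,τ) to E. Without it a minimizer may fail to exist, e.g. F=ℓ¹ with the weak-* topology, f_μ=Σ(1−1/n)μ_n, L(y,w)=2|y−w|, y=1. *)

(* Defs.v *)
From mathcomp Require Export all_boot all_order all_algebra.
From mathcomp Require Export all_classical all_reals all_analysis.

Set Implicit Arguments.
Unset Strict Implicit.
Unset Printing Implicit Defensive.

Export Order.TTheory GRing.Theory Num.Theory.
Export numFieldNormedType.Exports.

Local Open Scope classical_set_scope.
Local Open Scope ring_scope.

Definition bounded_op (R : realType) (V W : normedModType R) (T : V -> W) :=
  exists M : R, forall v, `|T v| <= M * `|v|.

(* [grkbs_fun] realizes the elements of the Banach space [grkbs_space] as
   functions; being linear and injective, it makes the space a space of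
   functions with the pointwise operations. *)
Record grkbs (R : realType) (X : Type) (E : normedModType R) := GRKBS {
  grkbs_space :> completeNormedModType R;
  grkbs_fun : {linear grkbs_space -> (X -> E)};
  grkbs_fun_inj : injective grkbs_fun;
  grkbs_eval_bounded : forall x, bounded_op (fun f => grkbs_fun f x)
}.

Arguments grkbs_fun {R X E} B : rename.

Section Configuration.
Context (R : realType) (X : Type) (E F : normedModType R).

Definition feature_fun (phi : X -> {linear F -> E}) (mu : F) : X -> E :=
  fun x => phi x mu.

Definition configuration (B : grkbs X E) (phi : X -> {linear F -> E}) :=
  [/\ forall x, bounded_op (phi x),
      range (grkbs_fun B) = range (feature_fun phi) &
      forall f : B,
        `|f| = inf [set `|mu| | mu in
                    [set mu | grkbs_fun B f = feature_fun phi mu]]].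

Definition objective (N : nat) (phi : X -> {linear F -> E})
    (x : 'I_N -> X) (y : 'I_N -> E) (L : E -> E -> R) (mu : F) : R :=
  N%:R^-1 * (\sum_(i < N) L (y i) (feature_fun phi mu (x i))) + `|mu|.

End Configuration.

(* A vector topology tau on F is represented by a topological vector space
   [Ft] together with a linear bijection [j : Ft -> F], which plays the role of
   the identity map from (F, tau) to the normed space F. *)
Section NormTopology.
Context (R : realType) (F : normedModType R) (Ft : tvsType R).

Definition norm_coercive (j : Ft -> F) :=
  forall alpha : R, 0 < alpha -> compact [set v : Ft | `|j v| <= alpha].

Definition norm_lsc (j : Ft -> F) :=
  lower_semicontinuous (fun v : Ft => (`|j v|)%:E).

End NormTopology.

Definition proper_function (R : realType) (T : Type) (f : T -> \bar R) :=
  (exists w, (f w < +oo)%E) /\ (forall w, (-oo < f w)%E).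

Definition coercive (R : realType) (E : topologicalType) (f : E -> R) :=
  forall alpha : R, compact [set w | f w <= alpha].

Definition extreme_points (R : realType) (V : lmodType R) (A : set V) : set V :=
  [set a | A a /\ forall (b c : V) (t : R), A b -> A c -> 0 < t < 1 ->
             a = t *: b + (1 - t) *: c -> b = a /\ c = a].

(* Main.v *)
(* A minimizer mu0 exists because the objective is lower semicontinuous for tau
   and its sublevel sets lie in compact balls. Put r = ||mu0|| and let A be the
   map mu |-> (f_mu(x_i))_i into R^(mN); then mu0 has least norm among all nu
   with A nu = A mu0. Take an extreme point z of the compact set of those v in
   the unit ball with A v = A mu0 / r. Extremality makes A injective on the
   linear space D of directions of the face of the ball at z, and minimality of
   the norm makes A mu0 independent of A(D), so dim D < mN. By Caratheodory's
   theorem in that face, z is a convex combination of at most mN extreme points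
   of the ball, and r z is the required minimizer. *)
From HB Require Import structures.
Require Import Defs.
From mathcomp Require Import ring lra.
Set Implicit Arguments.
Unset Strict Implicit.
Unset Printing Implicit Defensive.
Local Open Scope classical_set_scope.
Local Open Scope ring_scope.

(** * Faces of convex sets *)

Lemma convex_set_comb (R : realType) (V : lmodType R) (K : set V)
    (a b : V) (t : R) : convex_set K -> K a -> K b -> 0 <= t -> t <= 1 ->
  K (t *: a + (1 - t) *: b).
Proof.
move=> cK Ka Kb t0 t1.
by have := cK a b (Itv01 t0 t1) (mem_set Ka) (mem_set Kb); rewrite inE.
Qed.

(** For convex [K] containing [z], these vectors form the linear space of directions of the smallest
    face of [K] through [z]. *)
Definition face_dir (R : realType) (V : lmodType R) (K : set V) (z v : V) :=
  exists2 e : R, 0 < e & K (z + e *: v) /\ K (z - e *: v).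

Section FaceDirections.
Context (R : realType) (V : lmodType R) (K : set V).
Context (cK : convex_set K).

(** The coefficients enter as equations, so that each use reduces to scalar arithmetic. *)
Lemma convex_plane (z v w : V) (t s s' q q' s2 q2 : R) :
  K (z + s *: v + q *: w) -> K (z + s' *: v + q' *: w) -> 0 <= t -> t <= 1 ->
  s2 = t * s + (1 - t) * s' -> q2 = t * q + (1 - t) * q' ->
  K (z + s2 *: v + q2 *: w).
Proof.
move=> K1 K2 t0 t1 -> ->; have := convex_set_comb cK K1 K2 t0 t1.
congr K; rewrite !scalerDr !scalerA !scalerDl addrACA; congr (_ + _).
by rewrite addrACA scale1r scaleNr subrKC.
Qed.

Lemma convex_segment (z v : V) (s s' q : R) :
  K (z + s *: v) -> K (z + s' *: v) -> s <= q -> q <= s' -> K (z + q *: v).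
Proof.
move=> K1 K2 sq qs'; have [ss'|ss'] := ltP s s'; last first.
  by have <- : s = q by lra.
have d0 : s' - s != 0 by rewrite subr_eq0 gt_eqF.
rewrite -[_ + _]addr0 -(scale0r v).
apply: (@convex_plane z v v ((s' - q) / (s' - s)) s s' 0 0).
- by rewrite scale0r addr0.
- by rewrite scale0r addr0.
- by rewrite divr_ge0; lra.
- by rewrite ler_pdivrMr; lra.
- by field.
- by rewrite !mulr0 addr0.
Qed.

Lemma face_dirZ (z v : V) (c : R) : face_dir K z v -> face_dir K z (c *: v).
Proof.
move=> [e e0 [Kp Km]]; rewrite -scaleNr in Km.
(* Adding 1 to the denominator covers [c = 0]. *)
have c1 : 0 < `|c| + 1 by rewrite ltr_wpDl.
have /ler_normlP[d1 d2] : `|e / (`|c| + 1) * c| <= e.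
  rewrite normrM gtr0_norm ?divr_gt0// mulrAC ler_pdivrMr// ler_pM2l//.
  by rewrite lerDl.
exists (e / (`|c| + 1)); first exact: divr_gt0.
by rewrite !scalerA -scaleNr; split; apply: convex_segment Km Kp _ _ => //; lra.
Qed.

Lemma face_dirN (z v : V) : face_dir K z v -> face_dir K z (- v).
Proof. by rewrite -scaleN1r; exact: face_dirZ. Qed.

(** With a common step [q], the point [z + (q / 2) (v + w)] is the midpoint of [z + q v] and
    [z + q w]. *)
Lemma face_dirD (z v w : V) :
  face_dir K z v -> face_dir K z w -> face_dir K z (v + w).
Proof.
move=> [e e0 [Kp Km]] [f f0 [Lp Lm]]; rewrite -!scaleNr in Km Lm.
have m0 : 0 < Num.min e f by rewrite lt_min e0.
have me : Num.min e f <= e by rewrite ge_min lexx.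
have mf : Num.min e f <= f by rewrite ge_min lexx orbT.
have Kq q : `|q| <= Num.min e f -> K (z + q *: v + 0 *: w).
  move=> /ler_normlP[q1 q2]; rewrite scale0r addr0.
  by apply: convex_segment Km Kp _ _; lra.
have Lq q : `|q| <= Num.min e f -> K (z + 0 *: v + q *: w).
  move=> /ler_normlP[q1 q2]; rewrite scale0r addr0.
  by apply: convex_segment Lm Lp _ _; lra.
have mm : `|Num.min e f| <= Num.min e f by rewrite gtr0_norm.
have mn : `|- Num.min e f| <= Num.min e f by rewrite normrN.
exists (Num.min e f / 2); first exact: divr_gt0.
rewrite -scaleNr !scalerDr !addrA.
split; first by apply: (convex_plane (Kq _ mm) (Lq _ mm) (t := 1 / 2)); lra.
by apply: (convex_plane (Kq _ mn) (Lq _ mn) (t := 1 / 2)); lra.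
Qed.

Lemma face_dirB (z v w : V) :
  face_dir K z v -> face_dir K z w -> face_dir K z (v - w).
Proof. by move=> zv zw; apply: face_dirD => //; exact: face_dirN. Qed.

(** The homothety of ratio [d / (1 + d)] centred at the point [z - d (z1 - z)] of [K] sends [z1] to
    [z], hence a segment around [z1] to a parallel one around [z]. *)
Lemma face_dir_trans (z z1 v : V) :
  face_dir K z (z1 - z) -> face_dir K z1 v -> face_dir K z v.
Proof.
move=> [d d0 [_ Kd]] [e e0 [Kp Km]].
have d1 : 0 < 1 + d by lra.
have d1' : 1 + d != 0 by rewrite gt_eqF.
have key q : K (z1 + q *: v) -> K (z + (d / (1 + d) * q) *: v).
  have {1}-> : z1 = z + 1 *: (z1 - z) by rewrite scale1r subrKC.
  move=> Kq.
  have {}Kd : K (z + (- d) *: (z1 - z) + 0 *: v).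
    by rewrite scaleNr scale0r addr0.
  have : K (z + 0 *: (z1 - z) + (d / (1 + d) * q) *: v).
    apply: (convex_plane Kq Kd (t := d / (1 + d))).
    - by rewrite divr_ge0 //; lra.
    - by rewrite ler_pdivrMr //; lra.
    - by field.
    - by field.
  by rewrite scale0r addr0.
exists (d / (1 + d) * e); first by rewrite mulr_gt0 ?divr_gt0.
by rewrite -scaleNr -mulrN; split; apply: key; rewrite ?scaleNr.
Qed.

Lemma face_dir_mem (z v : V) : face_dir K z v -> K z.
Proof.
move=> [e e0 [Kp]]; rewrite -scaleNr => Km.
by rewrite -[z]addr0 -(scale0r v); apply: convex_segment Km Kp _ _; lra.
Qed.

(** If [z] lies strictly between [b] and [c], then [b - c] is a direction at [z], with step the
    smaller of the two weights. *)
Lemma extreme_face_dir (z : V) :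
  K z -> (forall v, face_dir K z v -> v = 0) -> extreme_points K z.
Proof.
move=> Kz z0; split=> // b c t Kb Kc /andP[t0 t1] zE.
have zb : z = b + (t - 1) *: (b - c).
  rewrite scalerBr addrA -[X in X + _ + _]scale1r -scalerDl subrKC.
  by rewrite -scaleNr opprB.
have K' q : 0 <= q -> q <= 1 -> K (b + (q - 1) *: (b - c)).
  move=> q0 q1.
  have Kb' : K (b + 0 *: (b - c)) by rewrite scale0r addr0.
  have Kc' : K (b + (-1) *: (b - c)) by rewrite scaleN1r opprB subrKC.
  by apply: convex_segment Kc' Kb' _ _; lra.
have /z0/eqP : face_dir K z (b - c).
  have m0 : 0 < Num.min t (1 - t) by rewrite lt_min t0 subr_gt0.
  have mt : Num.min t (1 - t) <= t by rewrite ge_min lexx.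
  have mt' : Num.min t (1 - t) <= 1 - t by rewrite ge_min lexx orbT.
  exists (Num.min t (1 - t)) => //; rewrite zb -scaleNr -!addrA -!scalerDl.
  by split; rewrite addrAC; apply: K'; lra.
rewrite subr_eq0 => /eqP bc.
split; last by rewrite -bc zb bc subrr scaler0 addr0.
by rewrite zb bc subrr scaler0 addr0.
Qed.

End FaceDirections.

(** * Dimension counting and Caratheodory's theorem in a face *)

(** Follow [A] by the quotient of the row space by the line of [u], which has dimension [n - 1]:
    what the composite kills is sent by [A] into that line. *)
Lemma linear_kill_direction (K : fieldType) (V : lmodType K) (D : V -> Prop)
    n (A : {linear V -> 'rV[K]_n}) (u : 'rV[K]_n) :
  u != 0 -> (forall w c, D w -> A w = c *: u -> w = 0) ->
  exists k (A' : {linear V -> 'rV[K]_k}),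
    n = k.+1 /\ forall w, D w -> A' w = 0 -> w = 0.
Proof.
move=> u0 inj.
exists (\rank (cokermx u)), (mulmxr (col_base (cokermx u)) \o A); split.
  rewrite mxrank_coker rank_rV u0; case: n A u u0 {inj} => [|n] A u u0.
    by rewrite thinmx0 eqxx in u0.
  by rewrite subn1.
move=> w Dw /= Aw0.
have /sub_rVP[c Ac] : (A w <= u)%MS.
  by rewrite submxE -[cokermx u]mulmx_base mulmxA Aw0 mul0mx.
exact: inj Ac.
Qed.

(** The trace of compactness on lines; closed balls have it in every dimension. *)
Definition ray_compact (R : realType) (V : lmodType R) (K : set V) :=
  forall z v, K z -> v != 0 ->
    exists2 t : R, K (z + t *: v) & forall s, K (z + s *: v) -> s <= t.

Section Caratheodory.
Context (R : realType) (V : lmodType R) (K : set V).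
Context (cK : convex_set K) (rK : ray_compact K).

(* Walking from [z] along [v] up to the last point of [K] loses the direction
   [v], hence one dimension. *)
Lemma exit_point (z v : V) n (A : {linear V -> 'rV[R]_n}) :
  face_dir K z v -> v != 0 -> (forall w, face_dir K z w -> A w = 0 -> w = 0) ->
  exists (t : R) k (A' : {linear V -> 'rV[R]_k}),
    [/\ 0 < t, K (z + t *: v), n = k.+1, face_dir K z (t *: v) &
      forall w, face_dir K (z + t *: v) w -> A' w = 0 -> w = 0].
Proof.
move=> zv v0 inj; have Kz := face_dir_mem cK zv.
have [t Kt tmax] := rK Kz v0.
have t0 : 0 < t.
  by have [e e0 [/tmax et _]] := zv; exact: lt_le_trans e0 et.
have ztv := face_dirZ cK t zv.
have sub w : face_dir K (z + t *: v) w -> face_dir K z w.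
  by apply: face_dir_trans => //; rewrite addrC addKr.
have Av0 : A v != 0 by apply: contra_neq v0; exact: inj.
have [|k [A' [nk injA']]] :=
    @linear_kill_direction _ _ (face_dir K (z + t *: v)) _ A _ Av0.
  move=> w c Dw Awv.
  have /eqP : w - c *: v = 0.
    apply: inj; last by rewrite linearB linearZ/= Awv subrr.
    by apply: face_dirB => //; [exact: sub|exact: face_dirZ].
  rewrite subr_eq0 => /eqP wcv.
  have [c0|c0] := eqVneq c 0; first by rewrite wcv c0 scale0r.
  (* For [c] nonzero, [v] would be a direction at the exit point, and one could walk beyond the
     maximal [t]. *)
  have : face_dir K (z + t *: v) v.
    by have := face_dirZ cK c^-1 Dw; rewrite wcv scalerA mulVf// scale1r.
  move=> [e e0 [+ _]]; rewrite -addrA -scalerDl => /tmax.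
  by rewrite gerDl leNgt e0.
by exists t, k, A'.
Qed.

(** Induction on [n], which bounds the dimension of the face at [z]: as long as a direction is left,
    walk to an exit point, whose face is smaller and lies in that of [z]. *)
Lemma face_extreme_point n (A : {linear V -> 'rV[R]_n}) (z : V) :
  K z -> (forall w, face_dir K z w -> A w = 0 -> w = 0) ->
  exists2 e, extreme_points K e & face_dir K z (e - z).
Proof.
elim: n A z => [|n IH] A z Kz inj.
  exists z; last first.
    by rewrite subrr; exists 1; rewrite ?scaler0 ?subr0 ?addr0.
  by apply: extreme_face_dir => // w /inj; apply; exact: thinmx0.
have [zext|] := pselect (forall w, face_dir K z w -> w = 0).
  exists z; first exact: extreme_face_dir.
  by rewrite subrr; exists 1; rewrite ?scaler0 ?subr0 ?addr0.
move=> /existsNP[v] /not_implyP[zv /eqP v0].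
have [t [k [A' [t0 Kt [nk] ztv inj']]]] := exit_point zv v0 inj.
subst k; have [e ext ze] := IH _ _ Kt inj'.
exists e => //.
rewrite -(subrK (z + t *: v) e) -addrA [_ - z]addrAC subrr add0r.
apply: face_dirD => //; apply: face_dir_trans ze => //.
by rewrite addrC addKr.
Qed.

(** Walk from an extreme point [e] of the face through [z] to an exit point; induction decomposes
    the exit point into at most [n] extreme points, and [e] is the additional one. *)
Lemma face_caratheodory n (A : {linear V -> 'rV[R]_n}) (z : V) :
  K z -> (forall w, face_dir K z w -> A w = 0 -> w = 0) ->
  exists p (g : 'I_p -> R) (f : 'I_p -> V),
    [/\ (p <= n.+1)%N, forall i, 0 < g i, \sum_i g i = 1,
      z = \sum_i g i *: f i & forall i, extreme_points K (f i)].
Proof.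
have single e m : extreme_points K e ->
    exists p (g : 'I_p -> R) (f : 'I_p -> V),
    [/\ (p <= m.+1)%N, forall i, 0 < g i, \sum_i g i = 1,
      e = \sum_i g i *: f i & forall i, extreme_points K (f i)].
  move=> ext; exists 1%N, (fun=> 1), (fun=> e).
  by split=> //; rewrite big_ord1 ?scale1r.
elim: n A z => [|n IH] A z Kz inj.
  apply: single.
  by apply: extreme_face_dir => // w /inj; apply; exact: thinmx0.
have [e ext ze] := face_extreme_point Kz inj.
have [->|ez] := eqVneq z e; first exact: single.
have {}ze : face_dir K z (z - e) by rewrite -opprB; exact: face_dirN.
have ez0 : z - e != 0 by rewrite subr_eq0.
have [t [k [A' [t0 Kt [nk] ztv inj']]]] := exit_point ze ez0 inj.
subst k; have [p [g [f [pn g0 g1 gf fext]]]] := IH _ _ Kt inj'.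
(* The weights come from [(1 + t) z = t e + (z + t (z - e))]. *)
have t1 : 1 + t != 0 by rewrite gt_eqF// addr_gt0.
have t1' : 0 < (1 + t)^-1 by rewrite invr_gt0 addr_gt0.
exists p.+1, (fun i => if unlift ord0 i is Some j then (1 + t)^-1 * g j
                       else t / (1 + t)),
  (fun i => if unlift ord0 i is Some j then f j else e).
split=> //.
- by move=> i; case: unliftP => [j|] _; rewrite ?mulr_gt0.
- rewrite big_ord_recl unlift_none; under eq_bigr do rewrite liftK.
  by rewrite -mulr_sumr g1; field.
- rewrite big_ord_recl unlift_none.
  under eq_bigr do rewrite liftK -scalerA.
  rewrite -scaler_sumr -gf; apply: (scalerI t1).
  rewrite scalerDr !scalerA mulrCA divff// mulr1 scale1r scalerDl scale1r.
  by rewrite scalerBr addrCA subrKC.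
- by move=> i; case: unliftP.
Qed.

End Caratheodory.

(** * Compactness and extreme points *)

(** If no [U i] covers [K], the nested sets [K \ U i] generate a proper filter; its cluster point in
    [K] lies in some open [U i], which misses [K \ U i]. *)
Lemma compact_chain_cover (T : topologicalType) (I : Type) (D : set I)
    (U : I -> set T) (K : set T) :
  compact K -> D !=set0 -> (forall i, D i -> open (U i)) ->
  (forall i j, D i -> D j -> U i `<=` U j \/ U j `<=` U i) ->
  K `<=` \bigcup_(i in D) U i -> exists2 i, D i & K `<=` U i.
Proof.
move=> cK [i0 Di0] oU chain KU; apply: contrapT => noi.
have KDU i : D i -> K `\` U i !=set0.
  by move=> Di; apply/set0P/eqP; rewrite setD_eq0 => KUi; apply: noi; exists i.
have fF : Filter (filter_from D (fun i => K `\` U i)).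
  apply: filter_from_filter; first by exists i0.
  move=> i j Di Dj; have [ij|ji] := chain i j Di Dj.
    by exists j => // x [Kx Ujx]; split; split=> // /ij.
  by exists i => // x [Kx Uix]; split; split=> // /ji.
have pF := filter_from_proper fF KDU.
have [|p [Kp clp]] := cK _ pF; first by exists i0 => // x [].
have [i Di Uip] := KU _ Kp.
have [||x [[_ nUx] Ux]] := clp (K `\` U i) (U i).
- by exists i.
- exact: open_nbhs_nbhs (conj (oU i Di) Uip).
- exact: nUx.
Qed.

(** Without a maximum, the sets where [f] is below [f x], for [x] in [K], form an open chain
    covering [K]; one of them would then contain its own [x]. *)
Lemma compact_usc_max (T : topologicalType) (R : realType) (K : set T)
    (f : T -> R) :
  compact K -> K !=set0 -> (forall c, open [set x | f x < c]) ->
  exists2 x, K x & forall y, K y -> f y <= f x.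
Proof.
move=> cK K0 usc; apply: contrapT => nomax.
have [|||x Kx KUx] := compact_chain_cover (I := T) (D := K)
  (U := fun x => [set y | f y < f x]) cK K0.
- by move=> x _; exact: usc.
- move=> x y _ _; have [xy|yx] := leP (f x) (f y); [left|right] => z /= zx.
    exact: lt_le_trans zx xy.
  exact: lt_trans zx yx.
- move=> x Kx; apply: contrapT => nox; apply: nomax; exists x => // y Ky.
  by rewrite leNgt; apply/negP => xy; apply: nox; exists y.
- by have := KUx _ Kx; rewrite /= ltxx.
Qed.

Lemma compact_lsc_min (T : topologicalType) (R : realType) (K : set T)
    (f : T -> R) :
  compact K -> K !=set0 -> (forall c, open [set x | c < f x]) ->
  exists2 x, K x & forall y, K y -> f x <= f y.
Proof.
move=> cK K0 lsc; have [|x Kx xmax] := compact_usc_max (f := \- f) cK K0.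
  by move=> c; under eq_set do rewrite ltrNl; exact: lsc.
by exists x => // y /xmax; rewrite lerN2.
Qed.

Lemma open_gtD (T : topologicalType) (R : realType) (f g : T -> R) :
  (forall c, open [set x | c < f x]) -> (forall c, open [set x | c < g x]) ->
  forall c, open [set x | c < f x + g x].
Proof.
move=> lf lg c.
rewrite (_ : [set _ | _] =
    \bigcup_(q in [set: R]) ([set x | q < f x] `&` [set x | c - q < g x])).
  by apply: bigcup_open => q _; apply: openI.
apply/seteqP; split=> [x /= cx|x [q _ [/= qf qg]]]; last by lra.
(* Half of the excess over [c] is left to each of [f] and [g]. *)
by exists (f x - (f x + g x - c) / 2) => //; split=> /=; lra.
Qed.

Lemma open_gt_sum (T : topologicalType) (R : realType) (I : Type) (r : seq I)
    (f : I -> T -> R) :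
  (forall i c, open [set x | c < f i x]) ->
  forall c, open [set x | c < \sum_(i <- r) f i x].
Proof.
move=> lf; elim: r => [|i r IH] c.
  under eq_set do rewrite big_nil.
  have [c0|c0] := ltP c 0.
    by rewrite (_ : [set _ | _] = setT); [exact: openT|by apply/seteqP; split].
  rewrite (_ : [set _ | _] = set0); first exact: open0.
  by apply/seteqP; split=> // x /=; rewrite ltNge c0.
under eq_set do rewrite big_cons; exact: open_gtD.
Qed.

(** * Separation and extreme points in locally convex spaces *)

Lemma tvs_cvgD (R : realType) (V : tvsType R) (T : Type) (F : set_system T)
    {FF : Filter F} (f g : T -> V) (a b : V) :
  f @ F --> a -> g @ F --> b -> (fun x => f x + g x) @ F --> a + b.
Proof.
move=> fa gb; apply: (@continuous2_cvg _ _ _ _ _ _ f g +%R a b) => //.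
exact: (@add_continuous V (a, b)).
Qed.

Lemma tvs_cvgZ (R : realType) (V : tvsType R) (T : Type) (F : set_system T)
    {FF : Filter F} (f : T -> R^o) (g : T -> V) (a : R^o) (b : V) :
  f @ F --> a -> g @ F --> b -> (fun x => f x *: g x) @ F --> a *: b.
Proof.
move=> fa gb; apply: (@continuous2_cvg _ _ _ _ _ _ f g *:%R a b) => //.
exact: (@scale_continuous R V (a, b)).
Qed.

(* The function is the gauge, centred at [a], of a convex neighbourhood of [a]
   avoiding [b]; Hahn-Banach is not needed. *)
Lemma convex_usc_separation (R : realType) (V : tvsType R) (a b : V) :
  accessible_space V -> a != b ->
  exists f : V -> R,
    [/\ forall c, open [set v | f v < c],
        forall v w s, 0 < s -> s < 1 ->
          f (s *: v + (1 - s) *: w) <= s * f v + (1 - s) * f w &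
        f a < f b].
Proof.
move=> T1 ab; have [A [oA /set_mem Aa Ab]] := T1 _ _ ab.
have [B Bconv [Bopen Bbasis]] := @locally_convex _ V.
have [U [BU Ua] UA] : filter_from [set U | B U /\ U a] id A.
  by apply: Bbasis; exact: open_nbhs_nbhs.
have cU : convex_set U by apply: Bconv; exact: mem_set.
have oU : open U by exact: Bopen.
have Ub : ~ U b by move=> /UA Ab'; move: Ab; rewrite inE.
pose G v := [set t : R | 0 < t /\ U (a + t^-1 *: (v - a))].
(* The neighbourhood [U] is absorbing around [a], so the gauge is finite. *)
have G0 v : G v !=set0.
  have cts : {for (0 : R^o), continuous (fun s : R^o => a + s *: (v - a))}.
    apply: tvs_cvgD; first exact: cvg_cst.
    by apply: tvs_cvgZ; [exact: cvg_id|exact: cvg_cst].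
  have : \forall s \near (0 : R), U (a + s *: (v - a)).
    by apply: cts; apply: open_nbhs_nbhs; split=> //=; rewrite scale0r addr0.
  move=> /nbhs_ballP[e /= e0 eU]; exists (e / 2)^-1; split.
    by rewrite invr_gt0 divr_gt0.
  rewrite invrK; apply: eU; rewrite /ball/= sub0r normrN gtr0_norm ?divr_gt0//.
  by rewrite ltr_pdivrMr// ltr_pMr// ltr1n.
have Glb v : has_lbound (G v) by exists 0 => t [/ltW].
have Ginf v : has_inf (G v) by [].
exists (fun v => inf (G v)); split.
- move=> c.
  rewrite (_ : [set _ | _] = \bigcup_(t in [set t | 0 < t < c])
      [set v | U (a + t^-1 *: (v - a))]).
    apply: bigcup_open => t _; apply: (@open_comp _ _ _ U) => // v _.
    apply: tvs_cvgD; first exact: cvg_cst.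
    apply: tvs_cvgZ; first exact: cvg_cst.
    by apply: tvs_cvgD; [exact: cvg_id|exact: cvg_cst].
  apply/seteqP; split=> [v /= /(inf_lt (G0 v))[t [t0 Ut] tc]|v].
    by exists t => //=; rewrite t0.
  by move=> [t /= /andP[t0 tc] Ut]; apply: le_lt_trans tc; exact: ge_inf.
- move=> v w s s0 s1; apply/ler_addgt0Pr => e e0.
  have [t1 [t10 U1] te1] := inf_adherent e0 (Ginf v).
  have [t2 [t20 U2] te2] := inf_adherent e0 (Ginf w).
  have s1' : 0 < 1 - s by rewrite subr_gt0.
  have p1 : 0 < s * t1 by rewrite mulr_gt0.
  have p2 : 0 < (1 - s) * t2 by rewrite mulr_gt0.
  have p0 : 0 < s * t1 + (1 - s) * t2 by rewrite addr_gt0.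
  have p0' : s * t1 + (1 - s) * t2 != 0 by rewrite gt_eqF.
  apply: (@le_trans _ _ (s * t1 + (1 - s) * t2)); last first.
    have := ler_wpM2l (ltW s0) (ltW te1).
    by have := ler_wpM2l (ltW s1') (ltW te2); lra.
  apply: ge_inf => //; split=> //.
  set t := _ + _ in p0 p0' *.
  have -> : a + t^-1 *: (s *: v + (1 - s) *: w - a) =
      a + (t^-1 * s) *: (v - a) + (t^-1 * (1 - s)) *: (w - a).
    rewrite -!scalerA -[RHS]addrA -scalerDr; congr (_ + _ *: _).
    by rewrite !scalerBr addrACA -opprD -scalerDl subrKC scale1r.
  (* Convexity of [U] with weight [s * t1 / t] on the point for [v] and the remaining weight on the
     point for [w]. *)
  apply: (convex_plane cU (t := s * t1 / t) (s := t1^-1) (s' := 0) (q := 0)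
    (q' := t2^-1)).
  + by rewrite scale0r addr0.
  + by rewrite scale0r addr0.
  + by rewrite divr_ge0// ltW.
  + by rewrite ler_pdivrMr// mul1r /t lerDl ltW.
  + by field; rewrite p0' gt_eqF.
  + by rewrite /t; field; rewrite p0' gt_eqF.
(* At [b] the gauge is at least 1: a smaller [t] would put [b] between [a] and a point of [U]. At
   [a] every positive number is admissible, such as 1/2. *)
- apply: (@lt_le_trans _ _ 1); last first.
    apply: lb_le_inf => // t [t0 Ut]; rewrite leNgt; apply/negP => t1.
    apply: Ub; have := convex_set_comb cU Ut Ua (ltW t0) (ltW t1).
    rewrite scalerDr scalerA mulfV ?gt_eqF// scale1r addrAC -scalerDl.
    by rewrite subrKC scale1r subrKC.
  apply: (@le_lt_trans _ _ (1 / 2)); last by lra.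
  apply: ge_inf => //; split; first by lra.
  by rewrite subrr scaler0 addr0.
Qed.

(** The existence half of Krein-Milman: a minimal closed extremal subset is a single point, since
    otherwise the points where a separating convex function is maximal form a smaller one. *)
Lemma compact_extreme_point (R : realType) (V : tvsType R) (K : set V) :
  accessible_space V -> compact K -> K !=set0 -> extreme_points K !=set0.
Proof.
move=> T1 cK K0.
(* complements of the nonempty closed extremal subsets of [K] *)
pose P (U : set V) := [/\ open U, K `\` U !=set0 &
  forall (b c : V) (t : R), K b -> K c -> 0 < t < 1 -> U b ->
    U (t *: b + (1 - t) *: c)].
have symP U (b c : V) (t : R) : P U -> K b -> K c -> 0 < t < 1 -> U c ->
    U (t *: b + (1 - t) *: c).
  move=> [_ _ PU] Kb Kc t01 Uc; rewrite addrC -{2}(subKr 1 t).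
  by apply: PU => //; lra.
have [|A [PA Amax]] := @Zorn_bigcup V P.
  move=> F FP chainF; split.
  - by apply: bigcup_open => U /FP[].
  - have [->|/set0P F0] := eqVneq F set0.
      by rewrite bigcup_set0 setD0.
    (* If the union of the chain covered [K], a single member would, by compactness. *)
    apply/set0P/eqP; rewrite setD_eq0 => KF.
    have [|||U /FP[_ /set0P/eqP + _]] :=
      compact_chain_cover (U := id) cK F0.
    + by move=> U /FP[].
    + exact: chainF.
    + exact: KF.
    + by rewrite setD_eq0.
  - move=> b c t Kb Kc t01 [U FU Ub]; exists U => //.
    by case: (FP U FU) => _ _; apply.
have [oA [a [Ka nAa]] Aext] := PA.
have only_a b : K b -> ~ A b -> b = a.
  move=> Kb nAb; apply/eqP; apply: contrapT => /negP; rewrite eq_sym => ab.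
  have [f [fusc fconv fab]] := convex_usc_separation T1 ab.
  have [|||m [Km nAm] mmax] := compact_usc_max (K := K `\` A) (f := f).
  - by rewrite setDE; apply: compact_closedI => //; exact: open_closedC.
  - by exists a.
  - exact: fusc.
  (* Adding the points where [f] is below its maximum over [K \ A] enlarges [A], since it adds [a],
     and keeps [P] by convexity of [f]. *)
  apply: (Amax (A `|` [set x | f x < f m])).
    split; first exact: subsetUl.
    move=> sub; apply: nAa; apply: sub; right; apply: lt_le_trans fab _.
    exact: mmax.
  split.
  - exact: openU.
  - by exists m; split=> // -[|/=]//; rewrite ltxx.
  - move=> b' c t Kb' Kc t01 A'b.
    have [Ab|nAb'] := pselect (A b'); first by left; exact: Aext.
    have [Ac|nAc] := pselect (A c); first by left; exact: symP.
    case: A'b => //= fb; right => /=; have /andP[t0 t1] := t01.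
    apply: le_lt_trans (fconv _ _ _ t0 t1) _.
    have fc : f c <= f m by exact: mmax.
    have : t * f b' < t * f m by rewrite ltr_pM2l.
    have : (1 - t) * f c <= (1 - t) * f m by rewrite ler_pM2l// subr_gt0.
    lra.
exists a; split=> // b c t Kb Kc t01 aE.
split; apply: only_a => // Ax; apply: nAa; rewrite aE.
  exact: Aext.
exact: symP.
Qed.

(** * The training problem *)

Lemma closed_ball_convex_set (R : realType) (F : normedModType R) :
  convex_set (closed_ball (0 : F) 1).
Proof.
move=> a b t.
rewrite closed_ballE// !inE /closed_ball_/= !sub0r !normrN => a1 b1.
apply: le_trans (ler_normD _ _) _; rewrite !normrZ !ger0_norm//; last first.
  by rewrite subr_ge0.
by rewrite -[X in _ <= X](subrKC t%:num) lerD// ler_piMr// subr_ge0.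
Qed.

(** The admissible steps are bounded by the diameter 2 over the norm of [v], and the triangle
    inequality makes their supremum admissible. *)
Lemma closed_ball_ray_compact (R : realType) (F : normedModType R) :
  ray_compact (closed_ball (0 : F) 1).
Proof.
move=> z v; rewrite closed_ballE// /closed_ball_/= sub0r normrN => z1 v0.
have nv : 0 < `|v| by rewrite normr_gt0.
pose S := [set t : R | `|z + t *: v| <= 1].
have S0 : S !=set0 by exists 0; rewrite /S/= scale0r addr0.
have Sub : has_ubound S.
  exists (2 / `|v|) => t St; rewrite ler_pdivlMr//.
  apply: le_trans (_ : `|t *: v| <= _).
    by rewrite normrZ ler_wpM2r// ler_norm.
  rewrite -(addrK z (t *: v)); apply: le_trans (ler_normB _ _) _.
  by rewrite addrC (_ : 2 = 1 + 1 :> R)// lerD// addrC.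
exists (sup S); last first.
  by move=> s; rewrite sub0r normrN => Ss; exact: ub_le_sup.
rewrite sub0r normrN; apply/ler_addgt0Pr => e e0.
have ev : 0 < e / `|v| by rewrite divr_gt0.
have [s Ss se] := sup_adherent ev (conj S0 Sub).
have sS : s <= sup S by exact: ub_le_sup.
have -> : z + sup S *: v = (z + s *: v) + (sup S - s) *: v.
  by rewrite -addrA -scalerDl subrKC.
apply: le_trans (ler_normD _ _) _; rewrite lerD// normrZ ger0_norm ?subr_ge0//.
by rewrite -ler_pdivlMr//; lra.
Qed.

Lemma exists_minimizer (R : realType) (X : Type) (N : nat)
    (E F : normedModType R) (phi : X -> {linear F -> E})
    (x : 'I_N -> X) (y : 'I_N -> E) (L : E -> E -> R)
    (Ft : tvsType R) (j : {linear Ft -> F}) :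
  (0 < N)%N -> bijective j -> norm_coercive j ->
  (forall c : R, open [set v : Ft | c < `|j v|]) ->
  (forall i : 'I_N, continuous (fun v : Ft => phi (x i) (j v))) ->
  (forall y0 : E, coercive (L y0)) ->
  exists v0 : Ft, forall nu : F,
    objective phi x y L (j v0) <= objective phi x y L nu.
Proof.
move=> N0 [j' jK j'K] jcoer Nlsc jphi Lcoer.
(* Compact sublevel sets are closed in the Hausdorff space [E], so coercivity gives lower
   semicontinuity. *)
have Llsc y0 c : open [set w | c < L y0 w].
  rewrite (_ : [set _ | _] = ~` [set w | L y0 w <= c]).
    apply: closed_openC; apply: compact_closed; last exact: Lcoer.
    exact: norm_hausdorff.
  by apply/seteqP; split=> w /=; rewrite ltNge => /negP.
have Lmin y0 : exists c, forall w, c <= L y0 w.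
  have [||w _ wmin] := compact_lsc_min (Lcoer y0 (L y0 0)) (f := L y0).
  - by exists 0 => /=.
  - exact: Llsc.
  exists (L y0 w) => w'; have [w0|w0] := leP (L y0 w') (L y0 0).
    exact: wmin.
  by apply: le_trans (ltW w0); apply: wmin => /=.
have [c cL] := choice (fun i => Lmin (y i)).
pose J mu := objective phi x y L mu.
(* Beyond radius [a] the lower bound [Jlow] exceeds [J 0], so minimizing over this ball suffices;
   the 1 makes [a] positive. *)
pose a := `|J 0| + `|N%:R^-1 * \sum_i c i| + 1.
have N0' : (0 : R) < N%:R by rewrite ltr0n.
have Jlow mu : N%:R^-1 * \sum_i c i + `|mu| <= J mu.
  rewrite /J /objective lerD2r ler_pM2l ?invr_gt0//.
  by apply: ler_sum => i _; exact: cL.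
have a0 : 0 < a by rewrite ltr_wpDl// addr_ge0.
have [||v _ vmin] := compact_lsc_min (jcoer a a0) (f := J \o j).
- by exists 0; rewrite /= linear0 normr0 ltW.
- move=> b; apply: open_gtD => // {}b.
  under eq_set do rewrite mulrC ltr_pdivlMr//.
  apply: open_gt_sum => i {}b.
  apply: (@open_comp _ _ _ [set w | b < L (y i) w]) => //.
  by move=> v _; exact: jphi.
exists v => nu; have [nua|nua] := leP `|nu| a.
  by rewrite -[nu]j'K; apply: vmin => /=; rewrite j'K.
apply: le_trans (vmin 0 _) _; first by rewrite /= linear0 normr0 ltW.
rewrite /= linear0; apply: le_trans (Jlow nu); rewrite -/(J 0).
have := ler_norm (J 0); have := ler_norm (- (N%:R^-1 * \sum_i c i)).
by rewrite normrN /a in nua *; lra.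
Qed.

(** * From a minimizer to a sparse minimizer *)

(** Supplies the separation axiom for the search of extreme points: translates of the open set where
    the norm is positive separate points. *)
Lemma lsc_norm_accessible (R : realType) (F : normedModType R) (Ft : tvsType R)
    (j : {linear Ft -> F}) :
  injective j -> (forall c : R, open [set v : Ft | c < `|j v|]) ->
  accessible_space Ft.
Proof.
move=> jinj Nlsc a b ab; exists [set v | 0 < `|j (v - b)|]; split.
- rewrite (_ : [set _ | _] =
    (fun v : Ft => v - b) @^-1` [set v | 0 < `|j v|])//.
  apply: open_comp; last exact: Nlsc.
  by move=> v _; apply: tvs_cvgD; [exact: cvg_id|exact: cvg_cst].
- by rewrite inE/= normr_gt0 -(linear0 j) (inj_eq jinj) subr_eq0.
- by rewrite inE/= subrr linear0 normr0 ltxx.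
Qed.

(** Coordinates in [E] merge the [N] evaluations into one row of [m * N] scalars, on which
    dimensions can be counted. *)
Lemma evaluation_row (R : realType) (X : Type) (m N : nat)
    (E F : normedModType R) (phi : X -> {linear F -> E}) (x : 'I_N -> X) :
  Vector.axiom m E ->
  exists A : {linear F -> 'rV[R]_(m * N)},
    forall mu nu, A mu = A nu <-> forall i, phi (x i) mu = phi (x i) nu.
Proof.
move=> [v2r v2r_lin [r2v v2rK _]].
pose A mu := mxvec (\matrix_(k < m, i < N) v2r (phi (x i) mu) 0 k).
have Alin : linear A.
  move=> c mu nu; rewrite /A -linearP; congr mxvec; apply/matrixP => k i.
  by rewrite !mxE linearP v2r_lin !mxE.
pose LA : {linear F -> 'rV[R]_(m * N)} :=
  HB.pack A (GRing.isLinear.Build _ _ _ _ A Alin).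
exists LA => mu nu; split=> [/(can_inj mxvecK)/matrixP AE i|AE]; last first.
  by congr mxvec; apply/matrixP => k i; rewrite !mxE AE.
apply: (can_inj v2rK); apply/rowP => k.
by have := AE k i; rewrite !mxE.
Qed.

Theorem theorem23 (R : realType) (X : Type) (m N : nat)
    (E F : completeNormedModType R) (B : grkbs X E)
    (phi : X -> {linear F -> E}) (hconf : configuration B phi)
    (hN : (0 < N)%N) (x : 'I_N -> X) (y : 'I_N -> E) (L : E -> E -> R)
    (* assumption (a) *)
    (Ft : tvsType R) (j : {linear Ft -> F}) (hj : bijective j)
    (hcoer : norm_coercive j) (hlsc : norm_lsc j)
    (* implicit in (a): bounded operators need not be tau-continuous, and without
       this clause a minimizer need not exist *)
    (hphi : forall i : 'I_N, continuous (fun v : Ft => phi (x i) (j v)))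
    (* assumption (b) *)
    (dotE : {dot E for (@idfun R)})
    (hdot : forall u : E, dotE u u = `|u| ^+ 2)
    (hdim : Vector.axiom m E)
    (* assumption (c) *)
    (hconv : forall y0 : E, convex_function setT (L y0))
    (hprop : forall y0 : E, proper_function (fun w => (L y0 w)%:E))
    (hLcoer : forall y0 : E, coercive (L y0)) :
  exists (mustar : F) (p : nat) (gamma : 'I_p -> R) (mu : 'I_p -> F),
    [/\ forall nu : F, objective phi x y L mustar <= objective phi x y L nu,
        mustar = \sum_(i < p) gamma i *: mu i,
        (p <= m * N)%N,
        (forall i, 0 < gamma i) /\ `|mustar| = \sum_(i < p) gamma i &
        forall i, extreme_points (closed_ball (0 : F) 1) (mu i)].
Proof.
have Nlsc (c : R) : open [set v : Ft | c < `|j v|].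
  by have /lower_semicontinuousP/(_ c) := hlsc.
have [v0 Jmin] := exists_minimizer y hN hj hcoer Nlsc hphi hLcoer.
have [j' jK j'K] := hj.
set mu0 := j v0 in Jmin; set r := `|mu0|.
(* Equal evaluations give equal loss terms, so comparing objectives compares norms. *)
have mono nu : (forall i, phi (x i) nu = phi (x i) mu0) -> r <= `|nu|.
  move=> nuE; have := Jmin nu; rewrite /objective.
  under [X in _ <= _ * X + _]eq_bigr do rewrite /feature_fun nuE.
  by rewrite lerD2l.
have [r0|r0] := eqVneq r 0.
  (* A zero minimizer is the empty sum. *)
  have mu00 : mu0 = 0 by apply/eqP; rewrite -normr_eq0 -/r r0.
  exists 0, 0%N, (fun=> 0), (fun=> 0); split.
  - by rewrite -mu00.
  - by rewrite big_ord0.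
  - by [].
  - by rewrite normr0 big_ord0; split=> // -[].
  - by case.
have {r0}r0 : 0 < r by rewrite lt_neqAle eq_sym r0 normr_ge0.
have T1 : accessible_space Ft := lsc_norm_accessible (can_inj jK) Nlsc.
pose S := [set v : Ft | `|j v| <= 1] `&`
  [set v | forall i, phi (x i) (j v) = r^-1 *: phi (x i) mu0].
have Scompact : compact S.
  apply: compact_closedI; first exact: hcoer.
  rewrite (_ : [set _ | _] = \bigcap_(i in [set: 'I_N])
      ((fun v => phi (x i) (j v)) @^-1` [set r^-1 *: phi (x i) mu0])).
    apply: closed_bigI => i _; apply: closed_comp => [v _|]; first exact: hphi.
    apply: accessible_closed_set1; apply: hausdorff_accessible.
    exact: norm_hausdorff.
  by apply/seteqP; split=> [v Sv i _|v Sv i]; [exact: Sv|exact: (Sv i I)].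
have S0 : S !=set0.
  exists (r^-1 *: v0); split => /=.
    by rewrite linearZ/= normrZ normfV ger0_norm ?normr_ge0// mulVf// gt_eqF.
  by move=> i; rewrite !linearZ.
have [e [[e1 eA] eext]] := compact_extreme_point T1 Scompact S0.
have [A Ainj] := evaluation_row phi x hdim.
pose Ball := closed_ball (0 : F) 1.
have BallE (v : F) : Ball v <-> `|v| <= 1.
  by rewrite /Ball closed_ballE// /closed_ball_/= sub0r normrN.
have cBall : convex_set Ball := @closed_ball_convex_set _ _.
(* Dividing [nu] by [s] gives the evaluations of [mu0], so [mono] bounds its norm below by [r]. *)
have scale_le (nu : F) (s : R) :
    `|nu| <= 1 -> 0 <= s -> A nu = s *: A mu0 -> s <= r^-1.
  move=> nu1; rewrite le_eqVlt => /orP[/eqP <- _|s0 nuA].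
    by rewrite invr_ge0 ltW.
  rewrite -[s]invrK lef_pV2 ?posrE ?invr_gt0//.
  apply: le_trans (mono (s^-1 *: nu) _) _; last first.
    by rewrite normrZ gtr0_norm ?invr_gt0// ler_piMr// invr_ge0 ltW.
  by apply/Ainj; rewrite linearZ/= nuA scalerA mulVf ?scale1r// gt_eqF.
have zA : A (j e) = r^-1 *: A mu0.
  by rewrite -linearZ; apply/Ainj => i; rewrite linearZ eA.
have u0 : A mu0 != 0.
  apply/eqP => u0; have : r <= `|0 : F|.
    by apply: mono; apply/Ainj; rewrite u0 linear0.
  by rewrite normr0 leNgt r0.
(* For [c] nonzero, one of the two moves along [w] stays in the ball but raises the coefficient of
   [A mu0] above [r^-1], against [scale_le]. For [c = 0] both moves stay in [S], and extremality of
   [e] forces [w = 0]. *)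
have faceinj w c : face_dir Ball (j e) w -> A w = c *: A mu0 -> w = 0.
  move=> [d d0 [/BallE wp /BallE wm]] Aw.
  have ri : 0 < r^-1 by rewrite invr_gt0.
  have [c0|c0|c0] := ltrgtP c 0.
  - have Am : A (j e - d *: w) = (r^-1 - d * c) *: A mu0.
      by rewrite [LHS]linearB/= [A (d *: w)]linearZ/= zA Aw scalerA -scalerBl.
    have dc : d * c < 0 by rewrite pmulr_rlt0.
    have s0 : 0 <= r^-1 - d * c by lra.
    by exfalso; have := scale_le _ _ wm s0 Am; lra.
  - have Ap : A (j e + d *: w) = (r^-1 + d * c) *: A mu0.
      by rewrite [LHS]linearD/= [A (d *: w)]linearZ/= zA Aw scalerA -scalerDl.
    have dc : 0 < d * c by rewrite mulr_gt0.
    have s0 : 0 <= r^-1 + d * c by lra.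
    by exfalso; have := scale_le _ _ wp s0 Ap; lra.
  have [w' jw'] : exists w', j w' = w by exists (j' w).
  have phiw i : phi (x i) w = 0.
    have /Ainj/(_ i) -> : A w = A 0 by rewrite Aw c0 scale0r linear0.
    by rewrite linear0.
  have Se s : `|j e + s *: w| <= 1 -> S (e + s *: w').
    move=> es; split=> /= [|i]; rewrite linearD linearZ/= jw'//.
    by rewrite linearD linearZ/= phiw scaler0 addr0.
  have [] := eext (e + d *: w') (e + (- d) *: w') 2^-1.
  - exact: Se.
  - by apply: Se; rewrite scaleNr.
  - lra.
  - rewrite !scalerDr addrACA -scalerDl !scalerA -scalerDl.
    rewrite subrKC scale1r mulrN (_ : 1 - 2^-1 = 2^-1 :> R); last by lra.
    by rewrite subrr scale0r addr0.
  move=> /eqP; rewrite -subr_eq0 addrC addKr scaler_eq0 gt_eqF//= => /eqP w'0 _.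
  by rewrite -jw' w'0 linear0.
(* Killing [A mu0] leaves [m * N - 1] coordinates, still injective on the face; Caratheodory's extra
   point brings the count to [m * N]. *)
have [k [A' [mNk A'inj]]] := linear_kill_direction u0 faceinj.
have [p [g [f [pk g0 g1 ef fext]]]] := face_caratheodory cBall
  (@closed_ball_ray_compact _ _) (proj2 (BallE _) e1) A'inj.
have phie i : phi (x i) (r *: j e) = phi (x i) mu0.
  by rewrite linearZ/= eA scalerA mulfV ?scale1r// gt_eqF.
(* At most [r] because [j e] is in the unit ball, at least [r] by minimality. *)
have nrE : `|r *: j e| = r.
  by apply/eqP; rewrite eq_le mono// andbT normrZ gtr0_norm// ler_piMr// ltW.
exists (r *: j e), p, (fun i => r * g i), f; split=> //.
- move=> nu; apply: le_trans (Jmin nu); rewrite /objective nrE.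
  by under eq_bigr do rewrite /feature_fun phie.
- by rewrite {1}ef scaler_sumr; apply: eq_bigr => i _; rewrite scalerA.
- by rewrite mNk.
- split=> [i|]; first by rewrite mulr_gt0.
  by rewrite nrE -mulr_sumr g1 mulr1.
Qed.
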